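(* If an SCC $F:\Theta\to 2^Z\setminus\{\emptyset\}$ is rationalizably implementable, then $F$ is mixed-Nash-A-implementable.
   Context: Standing setup: $\mathcal I=\{1,\dots,I\}$ finite, $I\ge 3$; $\Theta$ finite or countably infinite; $Z$ finite; $Y=\Delta(Z)$; $u_i^\theta:Z\to\mathbb R$ extended to lotteries by expected utility $U_i^\theta$. A mechanism $\mathcal M=\langle M=\times_iM_i,g:M\to Y\rangle$ has countable $M_i$; $g(\lambda)$ is the induced lottery of a profile; $MNE^{(\mathcal M,\theta)}$ is the set of mixed Nash equilibria at $\theta$. $F$ is mixed-Nash-A-implementable if some $\mathcal M$ has $\bigcup_{\lambda\in MNE^{(\mathcal M,\theta)}}\mathrm{SUPP}(g[\lambda])=F(\theta)$ for all $\theta$. Rationalizability: let $\mathcal S=\times_i2^{M_i}$, ordered by componentwise inclusion; for $S\in\mathcal S$, $b_i^{\mathcal M,\theta}(S)$ is the set of $m_i\in M_i$ for which there exists $\lambda_{-i}\in\Delta(M_{-i})$ with $\lambda_{-i}(m_{-i})>0\Rightarrow m_{-i}\in S_{-i}$ and $m_i\in\arg\max_{m_i'\in M_i}\sum_{m_{-i}}\lambda_{-i}(m_{-i})U_i^\theta(g(m_i',m_{-i}))$. The operator $b^{\mathcal M,\theta}=(b_i^{\mathcal M,\theta})_i$ is monotone; $S^{\mathcal M,\theta}=(S_i^{\mathcal M,\theta})_i$ denotes its largest fixed point. $F$ is rationalizably implementable if some $\mathcal M$ satisfies $\bigcup_{m\in S^{\mathcal M,\theta}}\mathrm{SUPP}[g(m)]=F(\theta)$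 for all $\theta\in\Theta$ (here $m\in S^{\mathcal M,\theta}$ means $m_i\in S_i^{\mathcal M,\theta}$ for all $i$). *)

(* Defs.v *)
From HB Require Import structures.
From mathcomp Require Import all_boot all_order all_algebra.
From mathcomp Require Import classical_sets boolp reals constructive_ereal ereal esum.
Set Implicit Arguments. Unset Strict Implicit. Unset Printing Implicit Defensive.
Import Order.TTheory GRing.Theory Num.Theory.
Local Open Scope ring_scope.
Local Open Scope classical_set_scope.

Definition dupd (I : eqType) (T : I -> Type) (f : forall j, T j) (i : I) (x : T i)
  : forall j, T j :=
  fun j => match i =P j with ReflectT e => eq_rect i T x j e | ReflectF _ => f j end.

Definition profile (n : nat) (msg : 'I_n -> countType) := {dffun forall i : 'I_n, msg i}.

Definition upd_prof (n : nat) (msg : 'I_n -> countType) (m : profile msg) (i : 'I_n)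
  (x : msg i) : profile msg := [ffun j => dupd (fun j => m j) x j].

Section Defs.
Variables (R : realType) (n : nat) (Z : finType).

Definition is_lottery (y : Z -> R) := (forall z, 0 <= y z) /\ \sum_(z : Z) y z = 1.

Definition is_distr (T : choiceType) (p : T -> R) :=
  (forall t, 0 <= p t) /\ \esum_(t in [set: T]) (p t)%:E = 1%E.

Record mechanism := Mechanism {
  msg : 'I_n -> countType;
  outcome : profile msg -> Z -> R;
  outcome_lottery : forall m, is_lottery (outcome m) }.

Definition SUPP (y : Z -> R) : set Z := [set z | 0 < y z].

Definition EU (u : Z -> R) (y : Z -> R) : R := \sum_(z : Z) y z * u z.

Definition ind_lottery (M : mechanism) (lam : forall i, msg M i -> R) (z : Z) : R :=
  fine (\esum_(m in [set: profile (msg M)])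
          ((\prod_(i < n) lam i (m i)) * @outcome M m z)%:E).

Definition is_MNE (Theta : Type) (M : mechanism) (u : 'I_n -> Theta -> Z -> R)
  (th : Theta) (lam : forall i, msg M i -> R) :=
  (forall i, is_distr (lam i)) /\
  forall i (l : msg M i -> R), is_distr l ->
    EU (u i th) (@ind_lottery M (dupd lam l)) <= EU (u i th) (@ind_lottery M lam).

Definition mixed_nash_A_implements (Theta : Type) (M : mechanism)
  (u : 'I_n -> Theta -> Z -> R) (F : Theta -> {set Z}) :=
  forall th, [set z | z \in F th] =
    \bigcup_(lam in [set lam | @is_MNE Theta M u th lam]) SUPP (@ind_lottery M lam).

Definition mixed_nash_A_implementable (Theta : Type) (u : 'I_n -> Theta -> Z -> R)
  (F : Theta -> {set Z}) := exists M : mechanism, mixed_nash_A_implements M u F.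

(* Belief of player i: a distribution mu over profiles, of which only the
   marginal on M_{-i} matters; the lottery induced by playing x against it is
   z |-> sum_m mu(m) g(x, m_{-i})(z). *)
Definition belief_lottery (M : mechanism) (i : 'I_n) (mu : profile (msg M) -> R)
  (x : msg M i) (z : Z) : R :=
  fine (\esum_(m in [set: profile (msg M)]) (mu m * @outcome M (upd_prof m x) z)%:E).

Definition bop (Theta : Type) (M : mechanism) (u : 'I_n -> Theta -> Z -> R) (th : Theta)
  (S : forall i, set (msg M i)) : forall i, set (msg M i) :=
  fun i => [set x | exists mu : profile (msg M) -> R,
     [/\ is_distr mu,
         (forall m, 0 < mu m -> forall j, j != i -> S j (m j)) &
         forall x' : msg M i,
           EU (u i th) (@belief_lottery M i mu x') <= EU (u i th) (@belief_lottery M i mu x)]].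

Definition is_largest_fixpoint (Theta : Type) (M : mechanism)
  (u : 'I_n -> Theta -> Z -> R) (th : Theta) (S : forall i, set (msg M i)) :=
  (forall i, @bop Theta M u th S i = S i) /\
  forall S' : forall i, set (msg M i), (forall i, @bop Theta M u th S' i = S' i) ->
    forall i, S' i `<=` S i.

Definition rationalizably_implements (Theta : Type) (M : mechanism)
  (u : 'I_n -> Theta -> Z -> R) (F : Theta -> {set Z}) :=
  forall th (S : forall i, set (msg M i)), @is_largest_fixpoint Theta M u th S ->
    [set z | z \in F th] =
      \bigcup_(m in [set m : profile (msg M) | forall i, S i (m i)]) SUPP (@outcome M m).

Definition rationalizably_implementable (Theta : Type) (u : 'I_n -> Theta -> Z -> R)
  (F : Theta -> {set Z}) := exists M : mechanism, rationalizably_implements M u F.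

End Defs.

(* Main.v *)
(* The mechanism M' extends the canonical mechanism of Maskin. Every player
   announces a state and an integer (among other things). If all announce
   (t, 0), the outcome is uniform on F t. If all but player i do, then i may
   trade, out of this lottery, a lottery that she expects from a rationalizable
   message a under the belief justifying a at t, for the one she expects from
   another message b; this is never profitable at t itself, so truthful
   announcements are an equilibrium. In all other cases the highest integer wins
   its alternative, up to a vanishing weight on the uniform lottery over the
   outcomes reachable in M.

   Conversely take an equilibrium at th. Raising integers without bound shows that
   in a contest on the support every player is indifferent between all reachable
   outcomes; then every message of M is rationalizable at th and F th is the set
   of reachable outcomes. Otherwise, at a profile where all but i announce t,
   each player either has no profitable trade at t, or considers all of F t as
   optimal among the reachable outcomes. In both cases the beliefs justifying her
   messages at t still justify them at th, so what is rationalizable at t is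
   rationalizable at th. *)
Require Import Defs.
From mathcomp Require Import all_boot all_order all_algebra finmap.
From mathcomp Require Import boolp classical_sets cardinality fsbigop.
From mathcomp Require Import reals constructive_ereal ereal esum.
From mathcomp Require Import ring lra.

Set Implicit Arguments. Unset Strict Implicit. Unset Printing Implicit Defensive.

(** * Sums of nonnegative families over arbitrary index types *)

Section Esum.
Import Order.TTheory GRing.Theory Num.Theory.
Local Open Scope classical_set_scope.
Local Open Scope ring_scope.
Local Open Scope ereal_scope.
Variable R : realType.

Lemma esum_ge_term (T : choiceType) (a : T -> \bar R) t :
  (forall t, 0 <= a t) -> a t <= \esum_(t in [set: T]) a t.
Proof.
move=> a0; apply: esum_ge; exists [set t]; first by split=> //; exact: finite_set1.
by rewrite fsbig_set1.
Qed.

(** Finite partial sums give one inequality for every factor. The converse is the same inequality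
    applied to the factor [c^-1]. *)
Lemma esumZl (T : choiceType) (c : R) (a : T -> \bar R) :
  (0 <= c)%R -> (forall t, 0 <= a t) ->
  \esum_(t in [set: T]) (c%:E * a t) = c%:E * \esum_(t in [set: T]) a t.
Proof.
move=> c0 a0.
have le (d : R) (b : T -> \bar R) : (0 <= d)%R -> (forall t, 0 <= b t) ->
    \esum_(t in [set: T]) (d%:E * b t) <= d%:E * \esum_(t in [set: T]) b t.
  move=> d0 b0; apply: ge_ereal_sup => _ [X [finX _] <-].
  rewrite -ge0_mule_fsumr//; apply: lee_wpmul2l; rewrite ?lee_fin//.
  by apply: esum_ge; exists X.
apply/eqP; rewrite eq_le; apply/andP; split; first exact: le.
case: (eqVneq c 0%R) => [->|cN0]; last have {}c0 : (0 < c)%R by rewrite lt0r cN0.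
  by rewrite mul0e esum1// => t _; rewrite mul0e.
have ci0 : (0 <= c^-1)%R by rewrite invr_ge0 ltW.
have := le c^-1%R (fun t => c%:E * a t) ci0
  (fun t => mule_ge0 (ltW c0 : 0 <= c%:E) (a0 t)).
under eq_esum do rewrite muleA -EFinM mulVf ?gt_eqF// mul1e.
move=> /(@lee_wpmul2l _ c%:E (ltW c0)).
by rewrite muleA -EFinM mulfV ?gt_eqF// mul1e.
Qed.

(** Once the finite sum of [a] is cancelled, the nonnegative differences [b - a] have a sum of at
    most 0. *)
Lemma esum_eq_of_le (T : choiceType) (a b : T -> R) :
  (forall t, 0 <= a t <= b t)%R ->
  \esum_(t in [set: T]) (a t)%:E < +oo ->
  \esum_(t in [set: T]) (b t)%:E <= \esum_(t in [set: T]) (a t)%:E ->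
  a =1 b.
Proof.
move=> ab fin le_ba t.
have a0 s : 0 <= (a s)%:E by rewrite lee_fin; case/andP: (ab s).
have d0 s : 0 <= (b s - a s)%:E by rewrite lee_fin subr_ge0; case/andP: (ab s).
move: le_ba; under eq_esum => s _ do rewrite -(subrK (a s) (b s)) addrC EFinD.
rewrite esumD//.
have finE : \esum_(t in [set: T]) (a t)%:E \is a fin_num.
  by rewrite ge0_fin_numE//; exact: esum_ge0.
rewrite -[leRHS]adde0 leeD2lE// => le0.
have := le_trans (esum_ge_term t d0) le0.
by rewrite lee_fin subr_le0 => ba; apply/eqP; rewrite eq_le ba; case/andP: (ab t) => _ ->.
Qed.

Lemma exchange_esum (S T : choiceType) (a : S -> T -> \bar R) :
  (forall s t, 0 <= a s t) ->
  \esum_(s in [set: S]) \esum_(t in [set: T]) a s t =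
  \esum_(t in [set: T]) \esum_(s in [set: S]) a s t.
Proof.
move=> a0; rewrite !esum_esum//.
rewrite (@reindex_esum _ _ _ ([set: T] `*`` (fun=> [set: S])) _ (fun p => (p.2, p.1)))//.
split=> //; first by move=> [s t] [s' t'] _ _ [-> ->].
by move=> [s t] _; exists (t, s).
Qed.

Lemma esum_indic (T : choiceType) (t : T) (a : T -> \bar R) :
  (forall s, 0 <= a s) -> (forall s, s != t -> a s = 0) ->
  \esum_(s in [set: T]) a s = a t.
Proof.
move=> a0 aN; rewrite -(esum_set1 (a0 t)) [RHS]esum_mkcond.
apply: eq_esum => s _; case: ifPn => // /negP st; apply: aN.
by apply/eqP => eq_st; apply: st; rewrite eq_st inE.
Qed.

End Esum.

(** * Expected utility and countable mixtures of lotteries *)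

Section Mixtures.
Import Order.TTheory GRing.Theory Num.Theory.
Local Open Scope classical_set_scope.
Local Open Scope ring_scope.
Variables (R : realType) (Z : finType).
Implicit Types (y : Z -> R) (v : Z -> R).

Lemma lottery_le1 y z : is_lottery y -> y z <= 1.
Proof. by case=> y0 <-; rewrite (bigD1 z)//= lerDl sumr_ge0. Qed.

Lemma lottery_supp_neq0 y : is_lottery y -> exists z, 0 < y z.
Proof.
move=> [y0 y1]; have /eqP : \sum_z y z != 0 by rewrite y1 oner_neq0.
move=> /eqP; rewrite psumr_neq0// => /hasP[z _ /= yz]; by exists z.
Qed.

Lemma EU_shift v c y : is_lottery y -> EU (fun z => v z + c) y = EU v y + c.
Proof.
move=> [_ y1]; rewrite /EU; under eq_bigr do rewrite mulrDr.
by rewrite big_split/= -mulr_suml y1 mul1r.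
Qed.

Lemma EU_ge0 v y : (forall z, 0 <= v z) -> is_lottery y -> 0 <= EU v y.
Proof. by move=> v0 [y0 _]; apply: sumr_ge0 => z _; exact: mulr_ge0. Qed.

Lemma EU_le v c y : is_lottery y -> (forall z, 0 < y z -> v z <= c) -> EU v y <= c.
Proof.
move=> [y0 y1] vc; rewrite -[leRHS]mul1r -y1 mulr_suml; apply: ler_sum => z _.
have := y0 z; rewrite le_eqVlt => /orP[/eqP <-|yz]; first by rewrite !mul0r.
by rewrite ler_pM2l// vc.
Qed.

Lemma EU_const v c y : is_lottery y -> (forall z, 0 < y z -> v z = c) -> EU v y = c.
Proof.
move=> [y0 y1] vc; rewrite -[RHS]mul1r -y1 mulr_suml; apply: eq_bigr => z _.
have := y0 z; rewrite le_eqVlt => /orP[/eqP <-|yz]; first by rewrite !mul0r.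
by rewrite vc.
Qed.

Lemma EU_max_supp v c y : is_lottery y -> (forall z, 0 < y z -> v z <= c) ->
  EU v y = c -> forall z, 0 < y z -> v z = c.
Proof.
move=> [y0 y1] vc EUc z yz.
have t0 w : 0 <= y w * (c - v w).
  have := y0 w; rewrite le_eqVlt => /orP[/eqP <-|yw]; first by rewrite mul0r.
  by rewrite mulr_ge0// subr_ge0 vc.
have : \sum_w y w * (c - v w) = 0.
  under eq_bigr do rewrite mulrBr.
  by rewrite sumrB -mulr_suml y1 mul1r -/(EU v y) EUc subrr.
move=> /eqP; rewrite psumr_eq0// => /allP /(_ z (mem_index_enum _)) /=.
by rewrite mulf_eq0 gt_eqF//= subr_eq0 => /eqP.
Qed.

(** Infinite sums are handled for nonnegative terms, so utilities are translated first; by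
    [EU_shift] this does not affect comparisons between lotteries. *)
Lemma utility_shift v : exists c, forall z, 0 <= v z + c.
Proof.
exists (\sum_z `|v z|) => z; rewrite (bigD1 z)//= addrA addr_ge0 ?sumr_ge0//.
by rewrite addrC -lerBlDr sub0r -normrN ler_norm.
Qed.

Section Mixture.
Variables (T : choiceType) (mu : T -> R).
Hypothesis mu_distr : is_distr mu.

Definition mixture (q : T -> Z -> R) z := fine (\esum_(t in [set: T]) (mu t * q t z)%:E).

Lemma esum_mul_le (f : T -> R) c : 0 <= c ->
  (forall t, 0 < mu t -> 0 <= f t <= c) ->
  (\esum_(t in [set: T]) (mu t * f t)%:E <= c%:E)%E.
Proof.
move=> c0 fc; case: mu_distr => mu0 mu1.
rewrite -[leRHS]mule1 -mu1 -esumZl//.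
apply: le_esum => t _; rewrite -EFinM lee_fin mulrC.
have := mu0 t; rewrite le_eqVlt => /orP[/eqP <-|mut]; first by rewrite !mulr0.
by rewrite ler_pM2r//; case/andP: (fc t mut).
Qed.

Lemma distr_supp_neq0 : exists t, 0 < mu t.
Proof.
case: mu_distr => mu0 mu1; apply: contrapT => /forallNP muN.
move: mu1; rewrite esum1 => [/eqP|t _]; first by rewrite eq_sym onee_eq0.
by congr EFin; apply/eqP; rewrite eq_le mu0 andbT leNgt; apply/negP/muN.
Qed.

Variable q : T -> Z -> R.
Hypothesis q_lottery : forall t, is_lottery (q t).

Let q0 t z : 0 <= q t z. Proof. by case: (q_lottery t). Qed.
Let mu0 t : 0 <= mu t. Proof. by case: mu_distr. Qed.

Lemma mixtureE z : (mixture q z)%:E = \esum_(t in [set: T]) (mu t * q t z)%:E.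
Proof.
rewrite /mixture fineK// ge0_fin_numE; last by apply: esum_ge0 => t _; rewrite lee_fin mulr_ge0.
apply: le_lt_trans (ltry 1); apply: esum_mul_le => // t _.
by rewrite q0 lottery_le1.
Qed.

Lemma EU_mixture v : (forall z, 0 <= v z) ->
  (EU v (mixture q))%:E = \esum_(t in [set: T]) (mu t * EU v (q t))%:E.
Proof.
move=> v0; rewrite /EU -sumEFin.
have t0 z t : (0 <= (mu t * q t z)%:E)%E by rewrite lee_fin mulr_ge0.
under eq_bigr => z _ do rewrite mulrC EFinM mixtureE -(esumZl (v0 z) (t0 z)).
rewrite -esum_sum; last by move=> t z _ _; rewrite -EFinM lee_fin !mulr_ge0.
apply: eq_esum => t _; rewrite mulr_sumr -sumEFin; apply: eq_bigr => z _.
by rewrite -EFinM mulrC mulrA.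
Qed.

Lemma mixture_lottery : is_lottery (mixture q).
Proof.
split=> [z|]; first by rewrite -lee_fin mixtureE; apply: esum_ge0 => t _; rewrite lee_fin mulr_ge0.
have := @EU_mixture (fun=> 1) (fun=> ler01).
under eq_esum => t _.
  have -> : EU (fun=> 1) (q t) = 1.
    by rewrite /EU; under eq_bigr do rewrite mulr1; case: (q_lottery t).
  rewrite mulr1; over.
case: mu_distr => _ -> [].
by rewrite /EU; under eq_bigr do rewrite mulr1.
Qed.

Lemma mixture_gt0 z : 0 < mixture q z <-> exists2 t, 0 < mu t & 0 < q t z.
Proof.
split=> [|[t mut qt]].
  rewrite -lte_fin mixtureE => pos; apply: contrapT => none.
  move: pos; rewrite esum1 ?ltxx// => t _; congr EFin.
  have := mu0 t; rewrite le_eqVlt => /orP[/eqP <-|mut]; first by rewrite mul0r.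
  have := q0 t z; rewrite le_eqVlt => /orP[/eqP <-|qt]; first by rewrite mulr0.
  by case: none; exists t.
rewrite -lte_fin mixtureE; apply: lt_le_trans (esum_ge_term t _).
  by rewrite lte_fin mulr_gt0.
by move=> s; rewrite lee_fin mulr_ge0.
Qed.

Lemma EU_mixture_le v c : (forall t, 0 < mu t -> EU v (q t) <= c) -> EU v (mixture q) <= c.
Proof.
move=> qc; have [d vd] := utility_shift v.
have d0 : 0 <= c + d.
  have [t mut] := distr_supp_neq0; apply: (@le_trans _ _ (EU v (q t) + d)).
    by rewrite -EU_shift//; exact: EU_ge0.
  by rewrite lerD2r qc.
rewrite -(lerD2r d) -EU_shift; last exact: mixture_lottery.
rewrite -lee_fin (EU_mixture vd); apply: esum_mul_le => // t mut.
by rewrite EU_ge0//= EU_shift// lerD2r qc.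
Qed.

End Mixture.
End Mixtures.

(** * Unilateral changes of a profile and product distributions *)

Section Profiles.
Import Order.TTheory GRing.Theory Num.Theory.
Local Open Scope classical_set_scope.
Local Open Scope ring_scope.

Lemma dupd_same (I : eqType) (T : I -> Type) (f : forall j, T j) i (x : T i) :
  dupd f x i = x.
Proof. by rewrite /dupd; case: eqP => // e; rewrite (eq_axiomK e). Qed.

Lemma dupd_other (I : eqType) (T : I -> Type) (f : forall j, T j) i (x : T i) j :
  j != i -> dupd f x j = f j.
Proof. by move=> /eqP ji; rewrite /dupd; case: eqP => // e; case: ji. Qed.

Lemma dupd_id (I : eqType) (T : I -> Type) (f : forall j, T j) i : dupd f (f i) = f.
Proof.
apply: functional_extensionality_dep => j.
by have [->|ji] := eqVneq j i; rewrite ?dupd_same// dupd_other.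
Qed.

Variables (n : nat) (msg : 'I_n -> countType).
Implicit Types m : profile msg.

Lemma upd_prof_same m i (x : msg i) : upd_prof m x i = x.
Proof. by rewrite ffunE dupd_same. Qed.

Lemma upd_prof_other m i (x : msg i) j : j != i -> upd_prof m x j = m j.
Proof. by move=> ji; rewrite ffunE dupd_other. Qed.

Lemma upd_prof_id m i : upd_prof m (m i) = m.
Proof. by apply/ffunP => j; rewrite ffunE (dupd_id (fun j => m j)). Qed.

Lemma upd_prof_upd m i (x x' : msg i) : upd_prof (upd_prof m x) x' = upd_prof m x'.
Proof.
apply/ffunP => j; have [->|ji] := eqVneq j i; first by rewrite !upd_prof_same.
by rewrite !upd_prof_other.
Qed.

Variable R : realType.
Implicit Types lam : forall i, msg i -> R.

Definition prod_distr lam m : R := \prod_(i < n) lam i (m i).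

Lemma prod_distr_dupd lam i (l : msg i -> R) m :
  prod_distr (dupd lam l) m = l (m i) * \prod_(j < n | j != i) lam j (m j).
Proof.
rewrite /prod_distr (bigD1 i)//= dupd_same; congr (_ * _).
by apply: eq_bigr => j ji; rewrite dupd_other.
Qed.

Lemma prod_distrD1 lam i m :
  prod_distr lam m = lam i (m i) * \prod_(j < n | j != i) lam j (m j).
Proof. by rewrite /prod_distr (bigD1 i). Qed.

Lemma prod_distr_ge0 lam m : (forall i x, 0 <= lam i x) -> 0 <= prod_distr lam m.
Proof. by move=> lam0; apply: prodr_ge0. Qed.

(* The involution (m, x) |-> (m with m i replaced by x, m i) exchanges the
   roles of [l] and [lam i]. *)
Lemma esum_prod_distr_dupd lam i (l : msg i -> R) (f : profile msg -> R) :
  (forall j x, 0 <= lam j x) -> is_distr (lam i) -> (forall x, 0 <= l x) ->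
  (forall m, 0 <= f m) ->
  \esum_(m in [set: profile msg]) (prod_distr (dupd lam l) m * f m)%:E =
  \esum_(m in [set: profile msg]) \esum_(x in [set: msg i])
    (prod_distr lam m * (l x * f (upd_prof m x)))%:E.
Proof.
move=> lam0 [_ lam1] l0 f0.
have rest0 m : 0 <= \prod_(j < n | j != i) lam j (m j) by apply: prodr_ge0.
rewrite [RHS]esum_esum; last first.
  by move=> m x _ _; rewrite lee_fin !mulr_ge0// prod_distr_ge0.
pose s (p : profile msg * msg i) := (upd_prof p.1 p.2, p.1 i).
rewrite (@reindex_esum _ _ _ ([set: profile msg] `*`` (fun=> [set: msg i])) _ s)/=; last first.
  split=> //.
    move=> [m x] [m' x'] _ _ [eqm eqx].
    have eqx' : x = x' by rewrite -(upd_prof_same m x) eqm upd_prof_same.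
    by rewrite -(upd_prof_id m i) eqx -(upd_prof_upd m x) eqm upd_prof_upd upd_prof_id eqx'.
  move=> [m x] _; exists (upd_prof m x, m i) => //.
  by rewrite /s/= upd_prof_upd upd_prof_id upd_prof_same.
under [RHS]eq_esum => p _ do rewrite /s/= upd_prof_upd upd_prof_id.
rewrite -(@esum_esum _ _ _ setT (fun=> [set: msg i]) (fun m x =>
  (prod_distr lam (upd_prof m x) * (l (m i) * f m))%:E)); last first.
  by move=> m x _ _; rewrite lee_fin !mulr_ge0// prod_distr_ge0.
apply: eq_esum => m _.
under eq_esum => x _.
  rewrite (prod_distrD1 _ i) upd_prof_same.
  under eq_bigr => j ji do rewrite upd_prof_other//.
  rewrite -mulrA mulrC EFinM; over.
rewrite esumZl ?mulr_ge0//; last by move=> x; rewrite lee_fin.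
by rewrite lam1 mule1 prod_distr_dupd mulrA (mulrC (l _)).
Qed.

Definition dirac (T : eqType) (x : T) : T -> R := fun y => (y == x)%:R.

Lemma dirac_distr (T : choiceType) (x : T) : is_distr (dirac x).
Proof.
split=> [y|]; first exact: ler0n.
by rewrite (esum_indic (t := x)) ?/dirac ?eqxx// => y /negPf ->.
Qed.

Lemma esum_dirac (T : choiceType) (x : T) (f : T -> R) : (forall y, 0 <= f y) ->
  \esum_(y in [set: T]) (dirac x y * f y)%:E = (f x)%:E.
Proof.
move=> f0; rewrite (esum_indic (t := x)) ?/dirac ?eqxx ?mul1r//.
  by move=> y; rewrite lee_fin mulr_ge0// ler0n.
by move=> y /negPf ->; rewrite mul0r.
Qed.

Lemma prod_distr_dirac m : prod_distr (fun i => dirac (m i)) = dirac m.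
Proof.
apply: funext => m'; rewrite /prod_distr /dirac; have [->|/eqP m'm] := eqVneq m' m.
  by apply: big1 => i _; rewrite eqxx.
apply/eqP; rewrite prodf_seq_eq0; apply: contrapT => /negP/hasPn alleq.
apply: m'm; apply/ffunP => i; have := alleq i (mem_index_enum _).
by case: (m' i =P m i) => //=; rewrite eqxx.
Qed.

(** A product of point masses has total mass 1. Its factors are exchanged for those of [lam] one
    player at a time, and each exchange preserves the mass. *)
Lemma prod_distr_distr lam : (forall i, is_distr (lam i)) -> is_distr (prod_distr lam).
Proof.
move=> lamP; split=> [m|]; first by apply: prod_distr_ge0 => i; case: (lamP i).
pose x i := projT1 (cid (distr_supp_neq0 (lamP i))).
(* Hybrid family after [k] exchanges; the points [x i] are arbitrary, their existence being all that
   matters. *)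
pose lam' k (i : 'I_n) := if (i < k)%N then lam i else dirac (x i).
have lam'P k i : is_distr (lam' k i) by rewrite /lam'; case: ifP => // _; exact: dirac_distr.
have lam'0 k i y : 0 <= lam' k i y by case: (lam'P k i).
suff mass k : (k <= n)%N -> \esum_(m in [set: profile msg]) (prod_distr (lam' k) m)%:E = 1%E.
  rewrite -(mass n)//; apply: eq_esum => m _; congr (_%:E).
  by apply: eq_bigr => i _; rewrite /lam' ltn_ord.
elim: k => [_|k IHk kn].
  pose x0 : profile msg := [ffun i => x i].
  have lam'E : lam' 0%N = fun i => dirac (x0 i).
    by apply: functional_extensionality_dep => i; rewrite /lam' ltn0 ffunE.
  under eq_esum do rewrite lam'E prod_distr_dirac.
  by case: (dirac_distr x0).
pose i := Ordinal kn.
have -> : lam' k.+1 = dupd (lam' k) (lam i).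
  apply: functional_extensionality_dep => j; have [->|ji] := eqVneq j i.
    by rewrite dupd_same /lam'/= ltnSn.
  rewrite dupd_other// /lam' ltnS leq_eqVlt.
  by have -> : (j == k :> nat) = false by apply: contra_neqF ji => /eqP jk; apply: val_inj.
rewrite -IHk ?(ltnW kn)//.
under eq_esum do rewrite -[prod_distr _ _]mulr1.
rewrite (@esum_prod_distr_dupd _ _ _ (fun=> 1))//; last by case: (lamP i).
apply: eq_esum => m _; under eq_esum do rewrite mulr1 EFinM.
have [l0 l1] := lamP i.
by rewrite esumZl ?l1 ?mule1 ?prod_distr_ge0// => y; rewrite lee_fin.
Qed.

End Profiles.

(** * Deviations of one player from a mixed equilibrium *)

Section BestReplies.
Import Order.TTheory GRing.Theory Num.Theory.
Local Open Scope classical_set_scope.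
Local Open Scope ring_scope.
Variables (R : realType) (n : nat) (Z : finType) (Theta : Type) (M : mechanism R n Z).
Variables (u : 'I_n -> Theta -> Z -> R) (th : Theta) (lam : forall i, msg M i -> R).
Arguments lam : clear implicits.
Hypothesis lam_MNE : is_MNE u th lam.
Variables (i : 'I_n) (c : R).
Let v z := u i th z + c.
Hypothesis v_ge0 : forall z, 0 <= v z.

Let lamP j : is_distr (lam j). Proof. by case: lam_MNE. Qed.
Let lam0 j x : 0 <= lam j x. Proof. by case: (lamP j). Qed.
Let P := prod_distr lam.
Let P_distr : is_distr P. Proof. exact: prod_distr_distr. Qed.
Let P0 m : 0 <= P m. Proof. exact: prod_distr_ge0. Qed.
Let W m := EU v (@outcome _ _ _ M m).
Let W0 m : 0 <= W m. Proof. by apply: EU_ge0 => //; exact: outcome_lottery. Qed.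
Let e (x : msg M i) : \bar R := \esum_(m in [set: profile (msg M)]) (P m * W (upd_prof m x))%:E.
Let e0 x : (0 <= e x)%E. Proof. by apply: esum_ge0 => m _; rewrite lee_fin mulr_ge0. Qed.

Let E : \bar R := \esum_(m in [set: profile (msg M)]) (P m * W m)%:E.

Let E_fin : E = (EU v (mixture P (@outcome _ _ _ M)))%:E.
Proof. by have := EU_mixture P_distr (@outcome_lottery _ _ _ M) v_ge0. Qed.

Let deviation_le (l : msg M i -> R) : is_distr l ->
  (\esum_(m in [set: profile (msg M)]) (prod_distr (dupd lam l) m * W m)%:E <=
   E)%E.
Proof.
move=> l_distr; have [_ /(_ i l l_distr)] := lam_MNE.
have dP : is_distr (prod_distr (dupd lam l)).
  apply: prod_distr_distr => j; have [->|ji] := eqVneq j i; first by rewrite dupd_same.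
  by rewrite dupd_other.
have out m := @outcome_lottery _ _ _ M m.
rewrite -(lerD2r c) -!EU_shift; [|exact: (mixture_lottery P_distr)|exact: (mixture_lottery dP)].
have EdP := EU_mixture dP out v_ge0.
by rewrite -lee_fin [X in (X <= _)%E]EdP -E_fin.
Qed.

Let pure_deviation x : (e x <= E)%E.
Proof.
apply: le_trans (deviation_le (dirac_distr R x)).
have [d0 _] := dirac_distr R x.
rewrite esum_prod_distr_dupd//; apply: le_esum => m _; under eq_esum do rewrite EFinM.
rewrite esumZl//; last by move=> y; rewrite lee_fin mulr_ge0.
by rewrite esum_dirac.
Qed.

(** The equilibrium payoff [E] is the average of the pure payoffs [e] under [lam i], and none of
    these exceeds [E]. Hence they equal [E] wherever [lam i] is positive. *)
Lemma MNE_pure_best_reply (x y : msg M i) : 0 < lam i x ->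
  (\esum_(m in [set: profile (msg M)]) (prod_distr lam m * EU v (outcome (upd_prof m y)))%:E <=
   \esum_(m in [set: profile (msg M)]) (prod_distr lam m * EU v (outcome (upd_prof m x)))%:E)%E.
Proof.
move=> lamx; rewrite -/(e x) -/(e y).
suff -> : e x = E by exact: pure_deviation.
have E_ge0 : (0 <= E)%E := le_trans (e0 x) (pure_deviation x).
have Efin : E \is a fin_num by rewrite E_fin.
have efin y' : e y' \is a fin_num.
  rewrite ge0_fin_numE//; apply: le_lt_trans (pure_deviation y') _.
  by rewrite -ge0_fin_numE.
have E_sum : E = \esum_(x' in [set: msg M i]) (lam i x' * fine (e x'))%:E.
  (* Replacing [lam i] by itself allows the sum to be split according to the message of player
     [i]. *)
  transitivity (\esum_(m in [set: profile (msg M)])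
      (prod_distr (dupd lam (lam i)) m * W m)%:E); first by rewrite dupd_id.
  rewrite esum_prod_distr_dupd// exchange_esum; last first.
    by move=> m x'; rewrite lee_fin !mulr_ge0.
  apply: eq_esum => x' _; under eq_esum do rewrite mulrCA EFinM.
  rewrite esumZl//; last by move=> m; rewrite lee_fin mulr_ge0.
  by rewrite EFinM fineK.
have [_ lam1] := lamP i.
have := @esum_eq_of_le _ _ (fun x' => lam i x' * fine (e x')) (fun x' => lam i x' * fine E).
move=> /(_ _ _ _ x) eqx; suff /(mulfI _) : lam i x * fine (e x) = lam i x * fine E.
  by rewrite gt_eqF// => /(_ isT) eqf; rewrite -(fineK (efin x)) eqf fineK.
apply: eqx.
- by move=> x'; rewrite mulr_ge0 ?fine_ge0//= ler_wpM2l// fine_le.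
- by rewrite -E_sum -ge0_fin_numE.
- under eq_esum do rewrite mulrC EFinM.
  rewrite esumZl ?fine_ge0//; last by move=> x'; rewrite lee_fin.
  by rewrite lam1 mule1 fineK// -E_sum.
Qed.

(* A Fatou argument: the limit payoffs L are dominated in expectation by those
   of the best reply x, so they cannot exceed them anywhere on the support. *)
Lemma MNE_limit_deviation x (y : nat -> msg M i) (L : profile (msg M) -> R) :
  0 < lam i x ->
  (forall m t, 0 < t -> exists K0, forall K, (K0 <= K)%N ->
     L m - t <= EU v (outcome (upd_prof m (y K)))) ->
  (forall m, 0 < prod_distr lam m -> EU v (outcome (upd_prof m x)) <= L m) ->
  forall m, 0 < prod_distr lam m -> EU v (outcome (upd_prof m x)) = L m.
Proof.
move=> lamx limL leL m Pm.
have bound m' : 0 <= P m' * W (upd_prof m' x) <= P m' * L m'.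
  rewrite mulr_ge0//=; have := P0 m'; rewrite le_eqVlt => /orP[/eqP <-|Pm'].
    by rewrite !mul0r.
  by rewrite ler_pM2l//; exact: leL.
have fin : (e x < +oo)%E by apply: le_lt_trans (pure_deviation x) _; rewrite E_fin ltry.
apply: (mulfI (lt0r_neq0 Pm)).
apply: (@esum_eq_of_le _ _ (fun m => P m * W (upd_prof m x)) (fun m => P m * L m)) => //.
apply: ge_ereal_sup => _ [X [finX _] <-].
apply/lee_addgt0Pr => t t0.
have [K0 K0P] := choice (fun m => limL m t t0).
(* The convergence is only pointwise in the profile, but a finite partial sum admits a common
   integer. *)
pose K := (\max_(m <- fset_set X) K0 m)%N.
apply: (@le_trans _ _ (e (y K) + t%:E)%E); last by apply: leeD => //; exact: MNE_pure_best_reply.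
(* The error [t] is distributed over the profiles with weights [P], so that the comparison becomes
   termwise. *)
have [_ P1] := P_distr.
rewrite -[t%:E]mule1 -P1 -esumZl ?(ltW t0)// -esumD; last 2 first.
- by move=> m' _; rewrite lee_fin mulr_ge0.
- by move=> m' _; rewrite -EFinM lee_fin mulr_ge0// ltW.
apply: esum_ge; exists X => //.
apply: lee_fsum => // m' Xm'.
rewrite -EFinM -EFinD lee_fin (mulrC t) -mulrDr ler_wpM2l//.
rewrite -lerBlDr; apply: K0P.
by apply: leq_bigmax_seq => //; rewrite in_fset_set// inE.
Qed.

End BestReplies.

(** * Rationalizable messages and the beliefs that justify them *)

Section Rationalizability.
Import Order.TTheory GRing.Theory Num.Theory.
Local Open Scope classical_set_scope.
Local Open Scope ring_scope.
Variables (R : realType) (n : nat) (Z : finType) (Theta : Type) (M : mechanism R n Z).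
Variable u : 'I_n -> Theta -> Z -> R.
Implicit Types (th : Theta) (S : forall i, set (msg M i)).

(** The union of all post-fixed points, which is the largest fixed point as in the Knaster-Tarski
    theorem. *)
Definition rationalizable th i (x : msg M i) :=
  exists2 S, (forall j, S j `<=` @bop R n Z Theta M u th S j) & S i x.
Arguments rationalizable : clear implicits.

Lemma bop_mono th S S' : (forall i, S i `<=` S' i) ->
  forall i, @bop R n Z Theta M u th S i `<=` @bop R n Z Theta M u th S' i.
Proof.
move=> SS' i x [mu [mu_distr muS best]]; exists mu; split=> // m mum j ji.
exact: SS' (muS m mum j ji).
Qed.

Lemma postfixed_rationalizable th S : (forall i, S i `<=` @bop R n Z Theta M u th S i) ->
  forall i, S i `<=` rationalizable th i.
Proof. by move=> postS i x Sx; exists S. Qed.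

Lemma rationalizable_postfixed th i :
  rationalizable th i `<=` @bop R n Z Theta M u th (rationalizable th) i.
Proof.
move=> x [S postS Sx]; apply: bop_mono (postS i x Sx).
exact: postfixed_rationalizable.
Qed.

Lemma rationalizable_largest_fixpoint th : is_largest_fixpoint u th (rationalizable th).
Proof.
have post := @rationalizable_postfixed th.
split=> [i|S fixS]; last by apply: postfixed_rationalizable => i; rewrite fixS.
apply/seteqP; split; last exact: post.
by apply: postfixed_rationalizable => j; exact: bop_mono.
Qed.

Definition justifies th i (x : msg M i) (mu : profile (msg M) -> R) :=
  [/\ is_distr mu,
      (forall m, 0 < mu m -> forall j, j != i -> rationalizable th j (m j)) &
      forall x' : msg M i, EU (u i th) (belief_lottery mu x') <= EU (u i th) (belief_lottery mu x)].

(** One justifying belief is chosen for each message; the zero function is a default when there is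
    none. *)
Definition belief th i (x : msg M i) : profile (msg M) -> R :=
  if pselect (exists mu, justifies th x mu) is left e then projT1 (cid e) else fun=> 0.

Lemma beliefP th i (x : msg M i) : rationalizable th i x -> justifies th x (belief th x).
Proof.
move=> /rationalizable_postfixed[mu just]; rewrite /belief.
by case: pselect => [e|[]]; [case: cid|exists mu].
Qed.

End Rationalizability.
Arguments rationalizable {R n Z Theta M} u th i.

(** * Uniform lotteries, and weights that increase to 1 *)

Section Uniform.
Import Order.TTheory GRing.Theory Num.Theory.
Local Open Scope ring_scope.
Variables (R : realType) (Z : finType).

Definition unif (A : {set Z}) z : R := (z \in A)%:R / #|A|%:R.

Lemma unif_gt0 (A : {set Z}) z : (0 < unif A z) = (z \in A).
Proof.
rewrite /unif; case zA : (z \in A); last by rewrite mul0r ltxx.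
by rewrite mul1r invr_gt0 ltr0n card_gt0; apply/set0Pn; exists z.
Qed.

Lemma unif_lottery (A : {set Z}) : A != finset.set0 -> is_lottery (unif A).
Proof.
move=> A0; split=> [z|]; first by rewrite divr_ge0.
have sumA : (\sum_z (z \in A) = #|A|)%N.
  by rewrite -sum1_card [RHS]big_mkcond; apply: eq_bigr => z _; case: ifP.
by rewrite -mulr_suml -natr_sum sumA mulfV// pnatr_eq0 cards_eq0.
Qed.

Lemma EU_unif1 (v : Z -> R) z : EU v (unif (finset.set1 z)) = v z.
Proof.
apply: EU_const; first by apply: unif_lottery; apply/set0Pn; exists z; rewrite finset.inE.
by move=> w; rewrite unif_gt0 finset.inE => /eqP ->.
Qed.

(** It vanishes at 0, so the integer 0 buys nothing, and it tends to 1 without attaining it, so a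
    larger integer is always a little better. *)
Definition wt k : R := k%:R / k.+1%:R.

Lemma wt_ge0 k : 0 <= wt k. Proof. by rewrite divr_ge0. Qed.

Lemma wt0 : wt 0 = 0. Proof. by rewrite /wt mul0r. Qed.

Lemma onem_wt k : 1 - wt k = k.+1%:R^-1.
Proof. by rewrite /wt -[X in X - _](@mulfV _ k.+1%:R) ?pnatr_eq0// -mulrBl -natrB// subSnn mul1r. Qed.

Lemma wt_lt1 k : wt k < 1.
Proof. by rewrite -subr_gt0 onem_wt invr_gt0. Qed.

Lemma wt_cvg (d t : R) : 0 < t -> exists K0, forall K, (K0 <= K)%N -> (1 - wt K) * d <= t.
Proof.
move=> t0; exists (Num.bound (d / t)) => K leK; rewrite onem_wt mulrC ler_pdivrMr//.
rewrite -ler_pdivrMl// mulrC; apply: le_trans (ler_norm _) _.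
apply: ltW; apply: lt_le_trans (archi_boundP (normr_ge0 _)) _.
rewrite ler_nat; apply: leq_trans _ (leqnSn K); apply: leq_trans leK.
by rewrite /Num.bound normr_id.
Qed.

End Uniform.

(** * The canonical mechanism and the supports of its outcomes *)

Section Canonical.
Import Order.TTheory GRing.Theory Num.Theory.
Local Open Scope classical_set_scope.
Local Open Scope ring_scope.
Variables (R : realType) (n : nat) (Z : finType) (Theta : countType).
Hypothesis n_ge3 : (3 <= n)%N.
Variables (u : 'I_n -> Theta -> Z -> R) (F : Theta -> {set Z}).
Hypothesis F_neq0 : forall th, F th != finset.set0.
Variable M : mechanism R n Z.
Hypothesis M_implements : rationalizably_implements M u F.
Variable m0 : profile (msg M).

Definition reach : {set Z} := [set z : Z | `[< exists m, 0 < @outcome _ _ _ M m z >]]%SET.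

Lemma reachP z : reflect (exists m, 0 < @outcome _ _ _ M m z) (z \in reach).
Proof. by rewrite finset.inE; exact: asboolP. Qed.

Lemma reach_neq0 : reach != finset.set0.
Proof.
have [z oz] := lottery_supp_neq0 (@outcome_lottery _ _ _ M m0).
by apply/set0Pn; exists z; apply/reachP; exists m0.
Qed.

Lemma F_rationalizableP th z :
  z \in F th <-> exists2 m : profile (msg M), (forall i, rationalizable u th i (m i)) & 0 < @outcome _ _ _ M m z.
Proof.
have /seteqP[FS SF] := M_implements (@rationalizable_largest_fixpoint R n Z Theta M u th).
by split=> [/FS[m rm om]|[m rm om]]; [exists m|apply: SF; exists m].
Qed.

Lemma F_reach th z : z \in F th -> z \in reach.
Proof. by move=> /F_rationalizableP[m _ om]; apply/reachP; exists m. Qed.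

(* The lottery that player i expects from playing b when she holds the belief
   justifying a at th. *)
Definition play th i (a b : msg M i) : Z -> R := belief_lottery (belief u th a) b.

Section Play.
Variables (th : Theta) (i : 'I_n) (a : msg M i).
Hypothesis ra : rationalizable u th i a.

Lemma play_lottery b : is_lottery (play th a b).
Proof.
have [mu_distr _ _] := beliefP ra.
exact: (mixture_lottery mu_distr (fun m => outcome_lottery (upd_prof m b))).
Qed.

Lemma play_gt0 b z : 0 < play th a b z <->
  exists2 m, 0 < belief u th a m & 0 < @outcome _ _ _ M (upd_prof m b) z.
Proof.
have [mu_distr _ _] := beliefP ra.
exact: (mixture_gt0 mu_distr (fun m => outcome_lottery (upd_prof m b))).
Qed.

Lemma play_reach b z : 0 < play th a b z -> z \in reach.
Proof. by move=> /play_gt0[m _ om]; apply/reachP; exists (upd_prof m b). Qed.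

(** Player [i] sends the rationalizable message [a], and her belief is carried by rationalizable
    messages of the others. *)
Lemma play_F z : 0 < play th a a z -> z \in F th.
Proof.
have [_ muS _] := beliefP ra.
move=> /play_gt0[m mum om]; apply/F_rationalizableP; exists (upd_prof m a) => // j.
have [->|ji] := eqVneq j i; first by rewrite upd_prof_same.
by rewrite upd_prof_other//; exact: muS mum j ji.
Qed.

Lemma play_best b : EU (u i th) (play th a b) <= EU (u i th) (play th a a).
Proof. by have [_ _] := beliefP ra; exact. Qed.

End Play.

(* A message announces a state and an integer; the other components are the
   pair (a, b) of messages of M proposed as whistle-blower and the alternative
   demanded in the integer game. *)
Definition cmsg (i : 'I_n) : countType := (Theta * nat * (msg M i * msg M i) * Z)%type.

Definition st i (x : cmsg i) : Theta := x.1.1.1.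
Definition rank i (x : cmsg i) : nat := x.1.1.2.
Definition from i (x : cmsg i) : msg M i := x.1.2.1.
Definition to i (x : cmsg i) : msg M i := x.1.2.2.
Definition demand i (x : cmsg i) : Z := x.2.

Definition agrees th i (x : cmsg i) := (st x == th) && (rank x == 0%N).

(** The message of [i] is unconstrained, so a fully truthful profile is unanimous around every
    player. *)
Definition unanimous (m : profile cmsg) i th := [forall j, (j != i) ==> agrees th (m j)].

Definition relevant th i (x : cmsg i) := (st x == th) && `[< rationalizable u th i (from x) >].

(* At th, the whistle-blower may trade the part [play th a a] of the uniform
   lottery on F th for [play th a b], at the rate wt k / #|F th|, which is
   increasing in her integer k but never reaches its supremum. *)
Definition menu th i (x : cmsg i) : Z -> R := fun z =>
  unif R (F th) z + if relevant th x
    then wt R (rank x) * ((play th (from x) (to x) z - play th (from x) (from x) z) / #|F th|%:R)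
    else 0.

(** A demand outside [reach] defaults to all of [reach], which keeps every contest outcome
    reachable. *)
Definition granted z : {set Z} := if z \in reach then finset.set1 z else reach.

Definition contest k z : Z -> R := fun z' =>
  wt R k * unif R (granted z) z' + (1 - wt R k) * unif R reach z'.

Definition player0 : 'I_n := Ordinal (leq_trans (isT : (0 < 3)%N) n_ge3).

Definition winner (m : profile cmsg) : 'I_n := [arg max_(i > player0) rank (m i)]%N.

(** In the pair [p], the first player is the possible dissident and the second, different from the
    first, supplies the state announced by the others. By [coutcome_unanimous] the choice of the
    pair is immaterial. *)
Definition coutcome (m : profile cmsg) : Z -> R :=
  if [pick p : 'I_n * 'I_n | (p.2 != p.1) && unanimous m p.1 (st (m p.2))] is Some p
  then menu (st (m p.2)) (m p.1)
  else contest (rank (m (winner m))) (demand (m (winner m))).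

Lemma third_player (i j : 'I_n) : exists l, (l != i) && (l != j).
Proof.
suff : (0 < #|~: (i |: [set j])%SET|)%N.
  by rewrite card_gt0 => /set0Pn[l]; rewrite !finset.inE negb_or => H; exists l.
rewrite cardsCs finset.setCK card_ord subn_gt0; apply: leq_ltn_trans n_ge3.
by rewrite cardsU1 cards1; case: (_ \notin _).
Qed.

Lemma unanimousP (m : profile cmsg) i th :
  reflect (forall j, j != i -> agrees th (m j)) (unanimous m i th).
Proof. exact: 'forall_implyP. Qed.

(** A player other than [i] and [j] announces both states; this is where three players are
    needed. *)
Lemma unanimous_inj (m : profile cmsg) i j th th' :
  unanimous m i th -> unanimous m j th' -> th = th'.
Proof.
move=> /unanimousP ui /unanimousP uj; have [l /andP[li lj]] := third_player i j.
by have /andP[/eqP <- _] := ui l li; have /andP[/eqP <- _] := uj l lj.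
Qed.

Lemma unif_F_lottery th : is_lottery (unif R (F th)).
Proof. exact: unif_lottery. Qed.

Lemma menu_rank0 th i (x : cmsg i) : rank x = 0%N -> menu th x = unif R (F th).
Proof. by move=> x0; apply: funext => z; rewrite /menu x0 wt0 mul0r if_same addr0. Qed.

Lemma coutcome_unanimous (m : profile cmsg) i th :
  unanimous m i th -> coutcome m = menu th (m i).
Proof.
move=> uni; rewrite /coutcome; case: pickP => [[j l] /= /andP[lj unj]|none].
  have st_l := unanimous_inj unj uni; rewrite st_l in unj *.
  have [->//|ij] := eqVneq j i.
  (* With two possible dissidents [i] and [j], both announce the integer 0, so both menus reduce to
     the same uniform lottery. *)
  move/unanimousP: uni => /(_ j ij)/andP[_ /eqP rj].
  rewrite eq_sym in ij; move/unanimousP: unj => /(_ i ij)/andP[_ /eqP ri].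
  by rewrite !menu_rank0.
have [l /andP[li _]] := third_player i i.
have := none (i, l); rewrite /= li /=.
by move/unanimousP: (uni) => /(_ l li)/andP[/eqP -> _]; rewrite uni.
Qed.

Lemma coutcome_contest (m : profile cmsg) : (forall i th, ~~ unanimous m i th) ->
  coutcome m = contest (rank (m (winner m))) (demand (m (winner m))).
Proof.
move=> none; rewrite /coutcome; case: pickP => [[j l] /= /andP[_ unj]|//].
by move: (none j (st (m l))); rewrite unj.
Qed.

Lemma F_card_gt0 th : (0 : R) < #|F th|%:R.
Proof. by rewrite ltr0n card_gt0. Qed.

(* The mass removed at z is wt k / #|F th| times a probability supported in F th. *)
Lemma menu_ge th i (x : cmsg i) z :
  (1 - wt R (rank x)) * unif R (F th) z <= menu th x z.
Proof.
rewrite /menu; have wt0 := wt_ge0 R (rank x).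
have [/andP[_ /asboolP rx]|_] := boolP (relevant th x); last first.
  by rewrite addr0 mulrBl mul1r gerBl mulr_ge0//; case: (unif_F_lottery th).
rewrite mulrBl mul1r lerD2l -mulrN ler_wpM2l// /unif -mulNr.
rewrite ler_pM2r ?invr_gt0 ?F_card_gt0//.
have [b0 _] := play_lottery rx (to x); have := b0 z.
have la := play_lottery rx (from x).
case zF : (z \in F th) => /=; first by have := lottery_le1 z la; rewrite mulr1n; lra.
suff -> : play th (from x) (from x) z = 0 by rewrite subr0 oppr0.
apply/eqP; rewrite eq_le la.1 andbT leNgt; apply/negP => /(play_F rx).
by rewrite zF.
Qed.

Lemma menu_gt0_F th i (x : cmsg i) z : z \in F th -> 0 < menu th x z.
Proof.
move=> zF; apply: lt_le_trans (menu_ge th x z).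
by rewrite mulr_gt0 ?unif_gt0// subr_gt0 wt_lt1.
Qed.

Lemma menu_gt0 th i (x : cmsg i) z : 0 < menu th x z ->
  z \in F th \/ [/\ rank x != 0%N, relevant th x & 0 < play th (from x) (to x) z].
Proof.
rewrite /menu; case zF : (z \in F th); first by left.
move=> pos; right; move: pos.
have -> : unif R (F th) z = 0 by rewrite /unif zF mul0r.
rewrite add0r; case: (boolP (relevant th x)) => [rel|]; last by rewrite ltxx.
have [r0|rN0] := eqVneq (rank x) 0%N; first by rewrite r0 wt0 mul0r ltxx.
have /andP[_ /asboolP rx] := rel => pos; split=> //.
have wt0 := wt_ge0 R (rank x).
rewrite ltNge; apply/negP => bN; move: pos; rewrite ltNge => /negP; apply.
rewrite mulr_ge0_le0// pmulr_lle0 ?invr_gt0 ?F_card_gt0//.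
by have [a0 _] := play_lottery rx (from x); have := a0 z; lra.
Qed.

Lemma menu_lottery th i (x : cmsg i) : is_lottery (menu th x).
Proof.
have [u0 u1] := unif_F_lottery th; split=> [z|].
  by apply: le_trans (menu_ge th x z); rewrite mulr_ge0// subr_ge0 ltW// wt_lt1.
rewrite big_split/= u1; case: (boolP (relevant th x)) => [/andP[_ /asboolP rx]|_].
  rewrite -mulr_sumr -mulr_suml sumrB.
  have [_ ->] := play_lottery rx (to x); have [_ ->] := play_lottery rx (from x).
  by rewrite subrr mul0r mulr0 addr0.
by rewrite big1 ?addr0.
Qed.

Lemma menu_reach th i (x : cmsg i) z : 0 < menu th x z -> z \in reach.
Proof.
move=> /menu_gt0[/F_reach//|[_ /andP[_ /asboolP rx]]].
exact: play_reach.
Qed.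

Lemma granted_neq0 z : granted z != finset.set0.
Proof.
rewrite /granted; case: ifP => _; last exact: reach_neq0.
by apply/set0Pn; exists z; rewrite finset.inE.
Qed.

Lemma contest_lottery k z : is_lottery (contest k z).
Proof.
have [g0 g1] := unif_lottery R (granted_neq0 z).
have [r0 r1] := unif_lottery R reach_neq0.
split=> [z'|]; first by rewrite addr_ge0 ?mulr_ge0 ?wt_ge0// subr_ge0 ltW// wt_lt1.
by rewrite big_split/= -!mulr_sumr g1 r1 !mulr1 subrKC.
Qed.

Lemma contest_gt0 k z z' : (0 < contest k z z') = (z' \in reach).
Proof.
have [r0 _] := unif_lottery R reach_neq0; have [g0 _] := unif_lottery R (granted_neq0 z).
have w1 := wt_lt1 R k; have w0 := wt_ge0 R k.
apply/idP/idP => [|zr]; last first.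
  by rewrite ltr_wpDl ?mulr_ge0// mulr_gt0 ?subr_gt0// unif_gt0.
apply: contraTT => zN; rewrite -leNgt /contest.
have -> : unif R reach z' = 0 by rewrite /unif (negPf zN) mul0r.
have -> : unif R (granted z) z' = 0; last by rewrite !mulr0 addr0.
rewrite /unif /granted; case: ifP => zr; last by rewrite (negPf zN) mul0r.
rewrite finset.inE; case: eqP => [zz|]; last by rewrite mul0r.
by move: zN; rewrite zz zr.
Qed.

Lemma coutcome_lottery m : is_lottery (coutcome m).
Proof. by rewrite /coutcome; case: pickP => *; [exact: menu_lottery|exact: contest_lottery]. Qed.

Lemma coutcome_reach m z : 0 < coutcome m z -> z \in reach.
Proof.
by rewrite /coutcome; case: pickP => [p _|_]; [exact: menu_reach|rewrite contest_gt0].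
Qed.

Definition canonical : mechanism R n Z := Mechanism coutcome_lottery.

(** * Payoffs in the canonical mechanism and the truthful equilibrium *)

Definition gain (v : Z -> R) th i (x : cmsg i) : R :=
  if relevant th x
  then (EU v (play th (from x) (to x)) - EU v (play th (from x) (from x))) / #|F th|%:R
  else 0.

(** The payoff is affine in the weight [wt R (rank x)], and [gain] is its slope. *)
Lemma EU_menu v th i (x : cmsg i) :
  EU v (menu th x) = EU v (unif R (F th)) + wt R (rank x) * gain v th x.
Proof.
rewrite /EU /menu /gain; under eq_bigr do rewrite mulrDl.
rewrite big_split/=; congr (_ + _); case: ifP => _.
  rewrite /EU -sumrB mulr_suml mulr_sumr; apply: eq_bigr => z _; ring.
by rewrite mulr0 big1// => z _; rewrite mul0r.
Qed.

Lemma EU_contest v k z : z \in reach ->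
  EU v (contest k z) = v z - (1 - wt R k) * (v z - EU v (unif R reach)).
Proof.
move=> zr; have <- : EU v (unif R (granted z)) = v z by rewrite /granted zr EU_unif1.
transitivity (wt R k * EU v (unif R (granted z)) + (1 - wt R k) * EU v (unif R reach)); last by ring.
by rewrite /EU !mulr_sumr -big_split; apply: eq_bigr => w _; rewrite mulrDl !mulrA.
Qed.

Lemma gain_le0 th i (x : cmsg i) : gain (u i th) th x <= 0.
Proof.
rewrite /gain; case: ifP => // /andP[_ /asboolP rx].
by rewrite pmulr_lle0 ?invr_gt0 ?F_card_gt0// subr_le0 play_best.
Qed.

Lemma truth_MNE th z : z \in F th ->
  exists2 lam, @is_MNE R n Z Theta canonical u th lam & 0 < @ind_lottery R n Z canonical lam z.
Proof.
(* Only the state and the integer 0 matter; the other components are fillers. *)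
move=> zF; pose m : profile cmsg := [ffun i => (th, 0%N, (m0 i, m0 i), z) : cmsg i].
have mE i : agrees th (m i) by rewrite /agrees ffunE !eqxx.
have uni (m' : profile cmsg) i : (forall j, j != i -> m' j = m j) -> unanimous m' i th.
  by move=> m'E; apply/unanimousP => j ji; rewrite m'E.
pose lam i := dirac R (m i).
have indE : @ind_lottery R n Z canonical lam = unif R (F th).
  apply: funext => z'; rewrite /ind_lottery.
  under eq_esum do rewrite -/(prod_distr lam _) prod_distr_dirac.
  rewrite (@esum_dirac R _ m (fun m => coutcome m z')); last by move=> m'; exact: (coutcome_lottery m').1.
  rewrite /= (coutcome_unanimous (uni m player0 _))// menu_rank0//.
  by case/andP: (mE player0) => _ /eqP.
exists lam; last by rewrite indE unif_gt0.
split=> [i|i l l_distr]; first exact: dirac_distr.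
rewrite indE.
have dP : is_distr (prod_distr (dupd lam l)).
  apply: prod_distr_distr => j; have [->|ji] := eqVneq j i; first by rewrite dupd_same.
  by rewrite dupd_other//; exact: dirac_distr.
apply: (EU_mixture_le dP coutcome_lottery) => m' m'P.
(* A deviation of [i] alone charges only profiles that agree with [m] elsewhere, so it leads to a
   menu at [th], where no trade is profitable. *)
have m'E j : j != i -> m' j = m j.
  move=> ji; apply/eqP; apply: contraTT m'P => m'j.
  rewrite /prod_distr (bigD1 j)//= dupd_other// /lam /dirac (negPf m'j) mul0r.
  by rewrite ltxx.
rewrite (coutcome_unanimous (uni _ _ m'E)) EU_menu gerDl.
by rewrite mulr_ge0_le0 ?wt_ge0 ?gain_le0.
Qed.

(** * Transfer of rationalizability from one state to another *)

Definition optimal th th' i (a b : msg M i) :=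
  forall b', EU (u i th) (play th' a b') <= EU (u i th) (play th' a b).

(* The best replies at th to the beliefs justifying messages at th' form a
   post-fixed point. *)
Lemma optimal_rationalizable th th' :
  (forall i a, rationalizable u th' i a -> optimal th th' a a) ->
  forall i a b, rationalizable u th' i a -> optimal th th' a b -> rationalizable u th i b.
Proof.
move=> opt i a b ra optb.
pose S j : set (msg M j) := [set y | exists2 x, rationalizable u th' j x & optimal th th' x y].
apply: (@postfixed_rationalizable R n Z Theta M u th S); last by exists a.
move=> j y [x rx xy]; have [mu_distr muS _] := beliefP rx.
exists (belief u th' x); split=> // m mum l lj.
by exists (m l); [exact: muS mum l lj|apply: opt; exact: muS mum l lj].
Qed.

Lemma optimal_F th th' :
  (forall i a, rationalizable u th' i a -> optimal th th' a a) ->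
  forall i a b z, rationalizable u th' i a -> optimal th th' a b ->
  0 < play th' a b z -> z \in F th.
Proof.
move=> opt i a b z ra optb /(play_gt0 ra)[m mum om].
have [_ muS _] := beliefP ra; have ratS := optimal_rationalizable opt.
apply/F_rationalizableP; exists (upd_prof m b) => // j.
have [->|ji] := eqVneq j i; first by rewrite upd_prof_same; exact: ratS optb.
by rewrite upd_prof_other//; have rj := muS m mum j ji; exact: ratS (rj) (opt _ _ rj).
Qed.

Lemma F_monotone th th' :
  (forall i a, rationalizable u th' i a -> optimal th th' a a) ->
  {subset F th' <= F th}.
Proof.
move=> opt z /F_rationalizableP[m rm om]; apply/F_rationalizableP; exists m => // i.
exact: optimal_rationalizable (rm i) (opt _ _ (rm i)).
Qed.

(** Under indifference every message is a best reply to any belief, for instance to the point mass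
    at [m0], so the full message sets are post-fixed. *)
Lemma indifferent_F th :
  (forall i, {in reach &, forall z z', u i th z = u i th z'}) -> {subset reach <= F th}.
Proof.
move=> indiff z /reachP[m om]; apply/F_rationalizableP; exists m => // i.
apply: (@postfixed_rationalizable R n Z Theta M u th (fun=> setT)) => // j x _.
have d0 := dirac_distr R m0.
exists (dirac R m0); split=> // x'.
have [z0 z0r] := set0Pn _ reach_neq0.
have EUc y : EU (u j th) (belief_lottery (dirac R m0) y) = u j th z0.
  apply: EU_const => [|z'].
    exact: (mixture_lottery d0 (fun m => outcome_lottery (upd_prof m y))).
  move=> /(mixture_gt0 d0 (fun m => outcome_lottery (upd_prof m y)))[m' _ om'].
  by apply: indiff => //; apply/reachP; exists (upd_prof m' y).
by rewrite !EUc.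
Qed.

(** * Equilibria of the canonical mechanism *)

Section Equilibrium.
Variables (th : Theta) (lam : forall i, cmsg i -> R).
Arguments lam : clear implicits.
Hypothesis lam_MNE : @is_MNE R n Z Theta canonical u th lam.

Let lam_distr i : is_distr (lam i). Proof. by case: lam_MNE => + _; exact. Qed.

Lemma prod_lam_gt0 (m : profile cmsg) : 0 < prod_distr lam m <-> forall i, 0 < lam i (m i).
Proof.
split=> [Pm i|lamm]; last by apply: prodr_gt0.
have [lam0 _] := lam_distr i.
rewrite lt0r lam0 andbT; apply: contraTneq Pm => lami.
by rewrite /prod_distr (bigD1 i)//= lami mul0r ltxx.
Qed.

Section Player.
Variable i : 'I_n.

Let c : R := projT1 (cid (utility_shift (u i th))).
Let v z := u i th z + c.
Let v_ge0 z : 0 <= v z. Proof. exact: (projT2 (cid (utility_shift (u i th)))). Qed.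

Let zmax : Z := projT1 (cid (set0Pn _ reach_neq0)).
Let best : Z := [arg max_(z > zmax in reach) v z]%O.

Let best_reach : best \in reach.
Proof. by rewrite /best; case: arg_maxP => //; rewrite /zmax; case: cid. Qed.

Let best_max z : z \in reach -> v z <= v best.
Proof.
rewrite /best; case: arg_maxP; first by rewrite /zmax; case: cid.
by move=> z' _; exact.
Qed.

Let unanimous_upd (m : profile cmsg) (x : cmsg i) t :
  unanimous (upd_prof m x) i t = unanimous m i t.
Proof.
by apply: eq_forallb => j; have [//|ji] := eqVneq j i; rewrite upd_prof_other.
Qed.

Let EU_le_best m : EU v (coutcome m) <= v best.
Proof. by apply: EU_le => [|z /coutcome_reach]; [exact: coutcome_lottery|exact: best_max]. Qed.

(* The limit, as her integer grows, of the payoff of a player who proposes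
   (a, b) against t and demands her best alternative. *)
Let limit_payoff t (a b : msg M i) (m : profile cmsg) : R :=
  if [pick j | (j != i) && unanimous m i (st (m j))] is Some j
  then EU v (unif R (F (st (m j)))) + gain v (st (m j)) ((t, 0%N, (a, b), best) : cmsg i)
  else v best.

Let limit_unanimous t a b m t' : unanimous m i t' ->
  limit_payoff t a b m =
  EU v (unif R (F t')) + gain v t' ((t, 0%N, (a, b), best) : cmsg i).
Proof.
move=> uni; rewrite /limit_payoff; case: pickP => [j /andP[_ unj]|none].
  by rewrite (unanimous_inj unj uni).
have [j /andP[ji _]] := third_player i i; have := none j; rewrite ji.
by move/unanimousP: (uni) => /(_ j ji)/andP[/eqP -> _]; rewrite uni.
Qed.

Let limit_contest t a b m : (forall t', ~~ unanimous m i t') -> limit_payoff t a b m = v best.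
Proof.
by move=> none; rewrite /limit_payoff; case: pickP => // j /andP[_]; rewrite (negPf (none _)).
Qed.

Let deviation t a b K : cmsg i := (t, K, (a, b), best).

Let winner_upd (m : profile cmsg) t a b K :
  (\max_j rank (m j) < K)%N -> winner (upd_prof m (deviation t a b K)) = i.
Proof.
move=> ltK; rewrite /winner; case: arg_maxnP => // w _ /(_ i isT).
have [//|wi] := eqVneq w i; rewrite /= upd_prof_same upd_prof_other// leqNgt.
by rewrite (leq_ltn_trans _ ltK)// (leq_bigmax w).
Qed.

Let limit_payoffP t a b m e : 0 < e -> exists K0, forall K, (K0 <= K)%N ->
  limit_payoff t a b m - e <= EU v (coutcome (upd_prof m (deviation t a b K))).
Proof.
move=> e0; have [[t' uni]|none] := pselect (exists t', unanimous m i t').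
  have [K0 K0P] := wt_cvg (gain v t' (deviation t a b 0)) e0.
  exists K0 => K /K0P le_e; rewrite (limit_unanimous _ _ _ uni).
  rewrite (@coutcome_unanimous _ i t') ?unanimous_upd// upd_prof_same EU_menu.
  move: le_e; rewrite mulrBl mul1r /gain /relevant /st /from /to /=; lra.
have none' t' : ~~ unanimous m i t' by apply/negP => uni; apply: none; exists t'.
have [K0 K0P] := wt_cvg (v best - EU v (unif R reach)) e0.
(* The successor makes [K] exceed every integer in [m], so that [i] wins alone. It also makes [K]
   nonzero, so the profile is not unanimous around another player. *)
exists (maxn K0 (\max_j rank (m j)).+1) => K; rewrite geq_max => /andP[/K0P le_e ltK].
rewrite limit_contest// coutcome_contest; last first.
  move=> j t'; have [->|ji] := eqVneq j i; first by rewrite unanimous_upd.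
  apply/negP => /unanimousP /(_ i); rewrite eq_sym => /(_ ji)/andP[_].
  by rewrite upd_prof_same => /eqP /= rk; move: ltK; rewrite (rk : K = 0%N).
by rewrite winner_upd// upd_prof_same EU_contest// lerD2l lerN2.
Qed.

(** Where the others are not unanimous the limit payoff is [v best], which bounds every payoff;
    domination by the limit thus needs checking only at unanimous profiles. *)
Let equilibrium_limit t a b x : 0 < lam i x ->
  (forall m t', 0 < prod_distr lam m -> unanimous m i t' ->
     wt R (rank x) * gain v t' x <= gain v t' (deviation t a b 0)) ->
  forall m, 0 < prod_distr lam m -> EU v (coutcome (upd_prof m x)) = limit_payoff t a b m.
Proof.
move=> lamx gx; apply: (MNE_limit_deviation lam_MNE v_ge0 lamx (y := deviation t a b)).
  by move=> m e; exact: limit_payoffP.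
move=> m Pm; have [[t' uni]|none] := pselect (exists t', unanimous m i t').
  rewrite (limit_unanimous _ _ _ uni) /= (@coutcome_unanimous _ i t') ?unanimous_upd//.
  by rewrite upd_prof_same EU_menu lerD2l; exact: gx uni.
rewrite limit_contest; first exact: (EU_le_best (upd_prof m x)).
by move=> t'; apply/negP => uni; apply: none; exists t'.
Qed.

Let gain_shift t (x : cmsg i) : gain v t x = gain (u i th) t x.
Proof.
rewrite /gain; case: ifP => // /andP[_ /asboolP rx].
by rewrite !EU_shift; [congr (_ / _); lra|exact: play_lottery|exact: play_lottery].
Qed.

Lemma contested_max m : 0 < prod_distr lam m -> (forall t, ~~ unanimous m i t) ->
  forall z z', 0 < coutcome m z -> z' \in reach -> u i th z' <= u i th z.
Proof.
move=> Pm none z z' mz z'r.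
have lami : 0 < lam i (m i) by have /prod_lam_gt0 := Pm; exact.
(* The deviation must cost nothing where the others are unanimous: a proposal with nonnegative gain
   is kept, and any other is replaced by the null trade of a message for itself. *)
suff [t [a [b H]]] : exists t a b, forall t',
    wt R (rank (m i)) * gain v t' (m i) <= gain v t' (deviation t a b 0).
  have := equilibrium_limit lami (fun m' t' _ _ => H t') Pm.
  rewrite upd_prof_id limit_contest// => EUm.
  rewrite -(lerD2r c) -/(v z) -/(v z').
  suff -> : v z = v best by exact: best_max.
  apply: EU_max_supp EUm _ mz; first exact: coutcome_lottery.
  by move=> w /coutcome_reach; exact: best_max.
have [g0|g0] := leP 0 (gain v (st (m i)) (m i)).
  exists (st (m i)), (from (m i)), (to (m i)) => t'.
  have -> : gain v t' (deviation (st (m i)) (from (m i)) (to (m i)) 0) = gain v t' (m i) by [].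
  have g0' : 0 <= gain v t' (m i).
    have [<-//|tN] := eqVneq (st (m i)) t'.
    by rewrite /gain /relevant (negPf tN).
  by rewrite ler_piMl// ltW// wt_lt1.
exists (st (m i)), (from (m i)), (from (m i)) => t'.
have -> : gain v t' (deviation (st (m i)) (from (m i)) (from (m i)) 0) = 0.
  by rewrite /gain; case: ifP => // _; rewrite subrr mul0r.
rewrite mulr_ge0_le0 ?wt_ge0//; have [<-|tN] := eqVneq (st (m i)) t'; first exact: ltW.
by rewrite /gain /relevant (negPf tN).
Qed.

(** Otherwise proposing [(a, b)] against [t] with growing integers would be strictly better at [m]
    in the limit. It loses nothing at unanimity on another state: there either her integer is 0 and
    her current trade has no weight, or the hypothesis on [t'] excludes such a state. *)
Lemma whistle_blower_gain m t : 0 < prod_distr lam m -> unanimous m i t ->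
  (rank (m i) != 0%N -> forall m' t', 0 < prod_distr lam m' -> unanimous m' i t' -> t' = t) ->
  forall a b, rationalizable u t i a ->
  EU (u i th) (play t a b) - EU (u i th) (play t a a) <=
    #|F t|%:R * (wt R (rank (m i)) * gain (u i th) t (m i)).
Proof.
move=> Pm uni only a b ra.
have lami : 0 < lam i (m i) by have /prod_lam_gt0 := Pm; exact.
have gE : gain (u i th) t (deviation t a b 0) =
    (EU (u i th) (play t a b) - EU (u i th) (play t a a)) / #|F t|%:R.
  by rewrite /gain /relevant eqxx; case: asboolP.
rewrite mulrC -ler_pdivrMr ?F_card_gt0// -gE leNgt; apply/negP => lt_g.
have H m' t' : 0 < prod_distr lam m' -> unanimous m' i t' ->
    wt R (rank (m i)) * gain v t' (m i) <= gain v t' (deviation t a b 0).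
  move=> Pm' uni'; have [->|t'N] := eqVneq t' t; first by rewrite !gain_shift ltW.
  have [r0|/only] := eqVneq (rank (m i)) 0%N; last first.
    by move=> /(_ m' t' Pm' uni') tt; rewrite tt eqxx in t'N.
  by rewrite r0 wt0 mul0r /gain /relevant /st/= eq_sym (negPf t'N).
have := equilibrium_limit lami H Pm.
rewrite upd_prof_id (limit_unanimous _ _ _ uni) (coutcome_unanimous uni) EU_menu.
by move=> /addrI; rewrite !gain_shift => eq_g; rewrite eq_g ltxx in lt_g.
Qed.

End Player.
(** A contest has all of [reach] as its support, so by [contested_max] each player finds every
    reachable outcome optimal. *)
Lemma contested_F m : 0 < prod_distr lam m -> (forall i t, ~~ unanimous m i t) ->
  {subset reach <= F th}.
Proof.
move=> Pm none; apply: indifferent_F => i z z' zr z'r.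
have supp w : w \in reach -> 0 < coutcome m w by rewrite coutcome_contest// contest_gt0.
by apply/eqP; rewrite eq_le !(contested_max Pm (none i)) ?supp.
Qed.

Lemma MNE_unanimous_inj m m' i t t' :
  (forall m, 0 < prod_distr lam m -> exists i t, unanimous m i t) ->
  0 < prod_distr lam m -> 0 < prod_distr lam m' ->
  rank (m i) != 0%N -> unanimous m i t -> unanimous m' i t' -> t' = t.
Proof.
move=> some Pm Pm' ri uni uni'; have [j /andP[ji _]] := third_player i i.
(* By independence this spliced profile also has positive probability. The nonzero integer of [i]
   forces unanimity around [i], where [j] announces [t'] and a third player announces [t]. *)
pose mj := upd_prof m (m' j).
have Pmj : 0 < prod_distr lam mj.
  apply/prod_lam_gt0 => l; have [->|lj] := eqVneq l j.
    by rewrite upd_prof_same; exact: (prod_lam_gt0 m').1.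
  by rewrite upd_prof_other//; exact: (prod_lam_gt0 m).1.
have [q [tau /unanimousP unq]] := some _ Pmj.
have qi : q = i.
  apply/eqP; apply: contraNT ri; rewrite eq_sym => /unq/andP[_].
  by rewrite upd_prof_other// eq_sym.
rewrite {q}qi in unq; have [l /andP[li lj]] := third_player i j.
have /andP[/eqP + _] := unq j ji; rewrite upd_prof_same.
have /unanimousP/(_ j ji)/andP[/eqP -> _] := uni' => ->.
have /andP[/eqP + _] := unq l li; rewrite upd_prof_other//.
by have /unanimousP/(_ l li)/andP[/eqP -> _] := uni => ->.
Qed.

Lemma MNE_outcome_F z : 0 < @ind_lottery R n Z canonical lam z -> z \in F th.
Proof.
move=> /(mixture_gt0 (prod_distr_distr lam_distr) coutcome_lottery)[m Pm mz].
have [[m' [Pm' none]]|] :=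
    pselect (exists m', 0 < prod_distr lam m' /\ forall i t, ~~ unanimous m' i t).
  exact: contested_F none _ (coutcome_reach mz).
move=> some'; have some m' : 0 < prod_distr lam m' -> exists i t, unanimous m' i t.
  move=> Pm'; apply: contrapT => none; apply: some'; exists m'; split=> // i t.
  by apply/negP => uni; apply: none; exists i, t.
have {some'} [i [t uni]] := some m Pm.
have bound j : unanimous m j t -> forall a b, rationalizable u t j a ->
    EU (u j th) (play t a b) - EU (u j th) (play t a a) <=
      #|F t|%:R * (wt R (rank (m j)) * gain (u j th) t (m j)).
  move=> unj; apply: whistle_blower_gain => // rj m' t' Pm'.
  exact: (MNE_unanimous_inj some Pm Pm' rj unj).
(* Applied to her own proposal, [bound] says that the gain is at most [wt] times itself, with [wt]
   below 1. *)
have gain_m j : unanimous m j t -> gain (u j th) t (m j) <= 0.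
  move=> unj; rewrite leNgt; apply/negP => g0.
  have [rel|irr] := boolP (relevant t (m j)); last by rewrite /gain (negPf irr) ltxx in g0.
  have /andP[_ /asboolP rx] := rel.
  have := bound j unj _ (to (m j)) rx.
  rewrite -ler_pdivrMl ?F_card_gt0// mulrC.
  have <- : gain (u j th) t (m j) =
      (EU (u j th) (play t (from (m j)) (to (m j))) -
       EU (u j th) (play t (from (m j)) (from (m j)))) / #|F t|%:R by rewrite /gain rel.
  by rewrite -[leLHS]mul1r ler_pM2r// leNgt wt_lt1.
(* A possible dissident has no profitable trade by [bound] and [gain_m]. For any other player, all
   of [F t] is optimal within [reach], and it contains the support of [play t a a]. *)
have opt j a : rationalizable u t j a -> optimal th t a a.
  move=> ra b; have [unj|nunj] := boolP (unanimous m j t).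
    rewrite -subr_le0; apply: le_trans (bound j unj a b ra) _.
    by rewrite mulr_ge0_le0// mulr_ge0_le0 ?wt_ge0 ?gain_m.
  have nunj' t' : ~~ unanimous m j t'.
    by apply: contra nunj => unj; rewrite -(unanimous_inj unj uni).
  have maxF z' w : z' \in F t -> w \in reach -> u j th w <= u j th z'.
    move=> z'F; apply: contested_max Pm nunj' _ _ _.
    by rewrite (coutcome_unanimous uni) menu_gt0_F.
  have [w /(play_F ra) wF] := lottery_supp_neq0 (play_lottery ra a).
  have -> : EU (u j th) (play t a a) = u j th w.
    apply: EU_const; first exact: play_lottery.
    move=> w' /(play_F ra) w'F.
    by apply/eqP; rewrite eq_le !maxF// (F_reach (th := t)).
  apply: EU_le; first exact: play_lottery.
  by move=> w' /(play_reach ra); exact: maxF.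
move: mz; rewrite (coutcome_unanimous uni) => /menu_gt0[zF|[ri rel pz]].
  exact: F_monotone opt _ zF.
have /andP[_ /asboolP rx] := rel.
(* The bound for the null trade makes the actual gain nonnegative, so the proposed message
   [to (m i)] is also a best reply to the belief. *)
apply: (optimal_F opt rx _ pz) => b; apply: le_trans (opt _ _ rx b) _.
have := bound i uni _ (from (m i)) rx; rewrite subrr pmulr_rge0 ?F_card_gt0//.
have wt_gt0 : 0 < wt R (rank (m i)) by rewrite divr_gt0// ltr0n lt0n.
by rewrite pmulr_rge0// /gain rel pmulr_lge0 ?invr_gt0 ?F_card_gt0// subr_ge0.
Qed.

End Equilibrium.

Lemma canonical_implements : mixed_nash_A_implements canonical u F.
Proof.
move=> th; apply/seteqP; split=> [z /= zF|z [lam lam_MNE lamz]].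
  by have [lam lam_MNE lamz] := truth_MNE zF; exists lam.
exact: MNE_outcome_F lam_MNE _ lamz.
Qed.

End Canonical.

Theorem theorem8 (R : realType) (n : nat) (Hn : 3 <= n) (Theta : countType)
  (Z : finType) (u : 'I_n -> Theta -> Z -> R) (F : Theta -> {set Z})
  (HF : forall th, F th != finset.set0) :
  rationalizably_implementable u F -> mixed_nash_A_implementable u F.
Proof.
move=> [M MF]; have [[th]|noTheta] := pselect (inhabited Theta); last first.
  (* Without states any mechanism implements [F]. Otherwise a point of [F th] yields a profile of
     [M], required as a filler by the construction. *)
  by exists M => th; case: noTheta.
have [z zF] := set0Pn _ (HF th).
have [m _ _] := (F_rationalizableP MF th z).1 zF.
exists (canonical Hn HF MF m); exact: canonical_implements.
Qed.
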